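(* There exists a function $\varepsilon:\mathbb{Z}_{>0}\to\mathbb{R}$ with $\varepsilon(n)\to 0$ as $n\to\infty$ such that for every positive integer $n$ there exists a triangulation of the real projective space $\mathbb{R}P^{n-1}$ with at most $e^{(\frac12+\varepsilon(n))\sqrt{n}\,\log n}$ vertices.
   Context: A triangulation of a manifold $M$ is a (finite) simplicial complex whose geometric realization is homeomorphic to $M$. $\log$ denotes the natural logarithm. *)

(* Defs.v *)
From HB Require Import structures.
From mathcomp Require Import all_boot all_order all_algebra.
From mathcomp Require Import all_classical all_reals all_analysis.

Set Implicit Arguments.
Unset Strict Implicit.
Unset Printing Implicit Defensive.

Import Order.TTheory GRing.Theory Num.Theory.
Import numFieldNormedType.Exports.

Local Open Scope quotient_scope.
Local Open Scope classical_set_scope.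
Local Open Scope ring_scope.

Definition homeomorphic (X Y : topologicalType) : Prop :=
  exists (f : X -> Y) (g : Y -> X),
    [/\ cancel f g, cancel g f, continuous f & continuous g].

(* An abstract simplicial complex whose vertex set is exactly 'I_m, so that m
   is its number of vertices; simplices are nonempty sets of vertices. *)
Record simplicial_complex (m : nat) := SimplicialComplex {
  simplices : {set {set 'I_m}};
  simplices_neq0 : finset.set0 \notin simplices;
  simplices_vertex : forall i : 'I_m, [set i]%SET \in simplices;
  simplices_closed : forall s t : {set 'I_m},
    s \in simplices -> t \subset s -> t != finset.set0 -> t \in simplices
}.

Section GeometricRealization.
Variables (R : realType) (m : nat).

Definition support_of (x : 'rV[R]_m) : {set 'I_m} :=
  [set i | x 0 i != 0]%SET.

(* Formal convex combinations of vertices (barycentric coordinates) whose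
   support is a simplex; as a type this carries the topology induced from
   R^m. *)
Definition geometric_realization (K : simplicial_complex m) : set 'rV[R]_m :=
  [set x : 'rV[R]_m |
     [/\ forall i, 0 <= x 0 i,
         \sum_i x 0 i = 1 &
         support_of x \in simplices K]].

Definition triangulates (K : simplicial_complex m) (X : topologicalType) :=
  homeomorphic (geometric_realization K) X.

End GeometricRealization.

Arguments geometric_realization R {m} K.

Section RealProjectiveSpace.
Variables (R : realType) (d : nat).

Definition punctured_space : set 'rV[R]_d.+1 := [set x : 'rV[R]_d.+1 | x != 0].

Definition collinear (x y : punctured_space) : bool :=
  `[< exists2 c : R, c != 0 & \val y = c *: \val x >].

Lemma collinear_refl : reflexive collinear.
Proof. by move=> x; apply/asboolP; exists 1; rewrite ?oner_neq0 ?scale1r. Qed.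

Lemma collinear_sym : symmetric collinear.
Proof.
have imp x y : collinear x y -> collinear y x.
  move=> /asboolP[c c0 yE]; apply/asboolP; exists c^-1; first by rewrite invr_eq0.
  by rewrite yE scalerA mulVf// scale1r.
by move=> x y; apply/idP/idP; exact: imp.
Qed.

Lemma collinear_trans : transitive collinear.
Proof.
move=> y x z /asboolP[b b0 yE] /asboolP[c c0 zE]; apply/asboolP.
by exists (c * b); rewrite ?mulf_neq0// zE yE scalerA.
Qed.

Canonical collinear_equiv :=
  EquivRel collinear collinear_refl collinear_sym collinear_trans.

(* The space of lines through the origin of R^(d+1), with the quotient
   topology. *)
Definition real_projective_space : topologicalType :=
  quotient_topology {eq_quot collinear}.

End RealProjectiveSpace.

Arguments punctured_space R d : clear implicits.

(* Main.v *)
Require Import Defs.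
From mathcomp Require Import all_boot all_order all_algebra.
From mathcomp Require Import all_classical all_reals all_analysis.
From mathcomp Require Import ring lra.

(** Let [v_1, ..., v_M] span [R^n].  When the polytope [conv {v_k, - v_k}] is
    simplicial, its boundary faces triangulate the sphere, and the antipodal
    map acts on them.  The quotient is a simplicial complex whose vertices are
    the pairs [{v_k, - v_k}], hence a triangulation of the projective space,
    as soon as no two faces contain the same two pairs with different relative
    signs ([faces_coherent]).  Both conditions are read on the polar body
    [Y = {y : |<y, v_k>| <= 1 for all k}]: the faces are the sets of indices
    [k] at which [|<y, v_k>| = 1] for some [y] in [Y], and the polytope is
    simplicial when the vectors of such a set are always linearly independent
    ([faces_free]).

    The homeomorphism ([active_complex_triangulates]) needs no inverse map.
    A nonzero [p] is written in exactly one way as [sum a_k v_k] with the [a_k]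
    supported on a face and signed accordingly ([certificate_uniq],
    [polar_certificate]).  The normalised pairs [(a, y)] form a compact space
    which maps onto the realization by [|a|] and onto the projective space by
    the line of [sum a_k v_k]; the two maps have the same fibres, so the two
    Hausdorff quotients agree ([compact_quotients_homeomorphic]).

    Independence is not an issue: multiplying each [v_k] by
    [1 / (1 + t^(k+1))] makes the faces independent for all small [t > 0], as
    each possible dependency excludes only the roots of a nonzero polynomial,
    and coherence survives for small [t] by compactness
    ([coherent_perturbation]).

    It remains to find a coherent family with few vectors, for [n <= q^2] with
    [q] about [sqrt n].  Place the coordinates in a [q] by [q] grid.  A vector
    of the family has a special row [b], in which it is [(1 + 1/|A|)] times the
    signed indicator of a set [A] of columns, and one entry [1] or [-1] in each
    other row.  If two such vectors lie on a common face, they have a common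
    nonzero entry of the same sign in the special row of the first, and no
    entries of opposite signs there ([optimal_pair_overlap]).  So the first
    vector cannot lie on a face with the second and on another face with its
    opposite, which is coherence.  The weight [1 + 1/j] works because it
    decreases with [j] while [j (1 + 1/j) = j + 1] increases: the former
    forbids entries of a wrong sign, the latter forces [A] to contain every
    column that competes with those of [A].

    There are at most [q 3^q (2 q)^q] vectors, and the logarithm of this number
    is [1/2 sqrt n ln n + ln n + O(sqrt n)] ([ln_card_grid_le]). *)

Set Implicit Arguments.
Unset Strict Implicit.
Unset Printing Implicit Defensive.

Import Order.TTheory GRing.Theory Num.Theory.
Import numFieldNormedType.Exports.

Local Open Scope classical_set_scope.
Local Open Scope ring_scope.

(** * Two quotients of a compact space *)

Definition to_set_type T (A : set T) (x : T) (Ax : A x) : A :=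
  exist _ x (mem_set Ax).

Lemma compact_set_type (X : topologicalType) (A : set X) :
  compact A -> compact [set: A].
Proof.
move=> cA F PF _.
have PF' : ProperFilter (set_val @ F) by exact: fmap_proper_filter.
have [|a [Aa cla]] := cA (set_val @ F) PF'.
  by rewrite /nbhs /=; apply: (filterS _ filterT) => x _; exact: set_valP.
exists (to_set_type Aa); split=> // U V FU.
rewrite /nbhs /= => -[B [[B' oB' <-] /= B'a BV]].
have FUO : (set_val @ F) (set_val @` U).
  by rewrite /nbhs /=; apply: filterS FU => x Ux; exists x.
have [|_ [[x Ux <-] B'x]] := cla _ B' FUO; first exact: open_nbhs_nbhs.
by exists x; split=> //; exact: BV.
Qed.

(** A continuous surjection from a compact space onto a Hausdorff space is a
    closed map, hence a quotient map. *)
Lemma compact_quotient_continuous (W X Z : topologicalType) (q : W -> X)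
    (f : X -> Z) :
  compact [set: W] -> hausdorff_space X -> continuous q ->
  (forall x, exists w, q w = x) -> continuous (f \o q) -> continuous f.
Proof.
move=> cW hX cq sq cfq; apply/continuous_closedP => C cC.
suff -> : f @^-1` C = q @` ((f \o q) @^-1` C).
  apply: compact_closed => //; apply: continuous_compact.
    exact: continuous_subspaceT.
  apply: (subclosed_compact _ cW) => //.
  by move/continuous_closedP : cfq; exact.
apply/seteqP; split=> [x Cfx|_ [w Cw <-]//].
by have [w qw] := sq x; exists w => //=; rewrite qw.
Qed.

Lemma compact_quotients_homeomorphic (W X Z : topologicalType)
    (q : W -> X) (r : W -> Z) :
  compact [set: W] -> hausdorff_space X -> hausdorff_space Z ->
  continuous q -> continuous r ->
  (forall x, exists w, q w = x) -> (forall z, exists w, r w = z) ->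
  (forall w w', q w = q w' <-> r w = r w') ->
  homeomorphic X Z.
Proof.
move=> cW hX hZ cq cr sq sr qr.
have [sx sxE] := choice sq; have [sz szE] := choice sr.
have fq w : r (sx (q w)) = r w by apply/qr; rewrite sxE.
have gr w : q (sz (r w)) = q w by apply/qr; rewrite szE.
exists (r \o sx), (q \o sz); split=> [x|z||] /=.
- by rewrite gr sxE.
- by rewrite fq szE.
- apply: (compact_quotient_continuous cW hX cq sq).
  by rewrite (_ : _ \o q = r)//; apply/funext => w /=.
- apply: (compact_quotient_continuous cW hZ cr sr).
  by rewrite (_ : _ \o r = q)//; apply/funext => w /=.
Qed.

(** Both spaces to be compared are shown to be Hausdorff by exhibiting enough
    real functions: coordinates on the realization, products of coordinates
    divided by the squared norm on the projective space. *)
Lemma separated_hausdorff (R : realType) (X : topologicalType) :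
  (forall x y : X, (forall f : X -> R, continuous f -> f x = f y) -> x = y) ->
  hausdorff_space X.
Proof.
move=> sep x y xy; apply: sep => f cf; apply: (@Rhausdorff R) => A B fA fB.
have [||z [Az Bz]] := xy (f @^-1` A) (f @^-1` B); [exact: cf|exact: cf|].
by exists (f z).
Qed.

Lemma mulr_fun_continuous (R : realType) (X : topologicalType) (f g : X -> R) :
  continuous f -> continuous g -> continuous (fun x => f x * g x).
Proof. by move=> cf cg x; apply: continuousM; [exact: cf|exact: cg]. Qed.

Lemma sumr_fun_continuous (R : realType) (X : topologicalType) (I : finType)
    (f : I -> X -> R) :
  (forall i, continuous (f i)) -> continuous (fun x => \sum_i f i x).
Proof.
move=> cf; rewrite unlock; elim: (index_enum I) => [|i r IHr] x /=.
  exact: cst_continuous.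
by apply: continuousD; [exact: cf|exact: IHr].
Qed.

Lemma set_val_coord_continuous (R : realType) n (A : set 'rV[R]_n) (i : 'I_n) :
  continuous (fun x : A => (set_val x : 'rV[R]_n) 0 i).
Proof.
move=> x; apply: (@continuous_comp _ _ _ _ (fun M : 'rV[R]_n => M 0 i)).
  exact: initial_continuous.
exact: coord_continuous.
Qed.

Lemma hausdorff_set_type (R : realType) n (A : set 'rV[R]_n) :
  hausdorff_space A.
Proof.
apply: (@separated_hausdorff R) => x y xy.
apply/val_inj/rowP => i.
exact: (xy _ (@set_val_coord_continuous _ _ _ i)).
Qed.

Lemma sumsq_gt0 (R : realType) n (x : 'rV[R]_n) :
  x != 0 -> 0 < \sum_i x 0 i ^+ 2.
Proof.
move=> x0; rewrite lt_neqAle sumr_ge0 ?andbT; last by move=> i _; exact: sqr_ge0.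
apply: contra x0 => /eqP/esym sx0; apply/eqP/rowP => i; rewrite mxE.
have /eqP : x 0 i ^+ 2 = 0 by apply: (psumr_eq0P (fun k _ => sqr_ge0 (x 0 k)) sx0).
by rewrite sqrf_eq0 => /eqP.
Qed.

Lemma eq_projectiveP (R : realType) d (p q : punctured_space R d) :
  (\pi_(real_projective_space R d) p = \pi_(real_projective_space R d) q)%qT <->
  exists2 c : R, c != 0 & \val q = c *: \val p.
Proof.
split=> [/eqmodP/asboolP//|pq]; apply/eqmodP; exact/asboolP.
Qed.

(** The entries [p_i p_j / |p|^2] of the orthogonal projection on the line of
    [p] do not depend on the choice of [p] on the line and determine it. *)
Lemma rp_hausdorff (R : realType) d :
  hausdorff_space (real_projective_space R d).
Proof.
apply: (@separated_hausdorff R) => x y xy.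
pose g i j (p : punctured_space R d) : R :=
  (\val p) 0 i * (\val p) 0 j / \sum_k (\val p) 0 k ^+ 2.
have gt0 (p : punctured_space R d) : 0 < \sum_k (\val p) 0 k ^+ 2.
  by apply: sumsq_gt0; exact: (set_valP p).
have cg i j : continuous (g i j).
  apply: mulr_fun_continuous.
    by apply: mulr_fun_continuous; exact: set_val_coord_continuous.
  move=> p; apply: continuousV; first by rewrite gt_eqF.
  apply: (@sumr_fun_continuous _ _ _
    (fun k (q : punctured_space R d) => (\val q) 0 k ^+ 2)) => k.
  by apply: mulr_fun_continuous; exact: set_val_coord_continuous.
have gE i j : g i j (repr x) = g i j (repr y).
  apply: (xy (g i j \o repr)); apply: repr_comp_continuous => // a b.
  move=> /eqP ab; have [c c0 bE] := (eq_projectiveP a b).1 ab; apply/eqP; rewrite /g bE.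
  have -> : \sum_k (c *: \val a) 0 k ^+ 2 = c ^+ 2 * \sum_k (\val a) 0 k ^+ 2.
    by rewrite mulr_sumr; apply: eq_bigr => k _; rewrite mxE exprMn.
  rewrite !mxE; field; rewrite c0/= gt_eqF//; exact: gt0.
rewrite -(reprK x) -(reprK y); apply/eq_projectiveP.
move: (repr x) (repr y) gE => {x y xy} p q gE.
have p0 : \val p != 0 by exact: (set_valP p).
have [j pj] : exists j, (\val p) 0 j != 0.
  apply/existsP; apply: contraT => /existsPn p0'; case/eqP: p0.
  by apply/rowP => j; rewrite mxE; move: (p0' j); rewrite negbK => /eqP.
(* Naming the squared norms keeps [field] from looking inside the sums. *)
have [sp [sq [sp0 sq0 pqE]]] : exists sp sq : R, [/\ 0 < sp, 0 < sq &
    forall i, (\val p) 0 i * (\val p) 0 j / sp =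
              (\val q) 0 i * (\val q) 0 j / sq].
  exists (\sum_k (\val p) 0 k ^+ 2), (\sum_k (\val q) 0 k ^+ 2).
  by split; [exact: gt0|exact: gt0|move=> i; exact: gE].
have qj : (\val q) 0 j != 0.
  apply/eqP => qj; have /eqP := pqE j; rewrite qj !mul0r.
  by rewrite !mulf_eq0 (negPf pj) invr_eq0 gt_eqF.
exists ((\val p) 0 j / sp * sq / (\val q) 0 j).
  by rewrite !(mulf_eq0, invr_eq0) (negPf pj) (negPf qj) !gt_eqF.
apply/rowP => i; rewrite mxE.
have /(congr1 (fun z => z * sq / (\val q) 0 j)) := pqE i.
rewrite divfK ?gt_eqF// mulfK// => <-; field.
by rewrite qj /= gt_eqF.
Qed.

Lemma rV_fun_continuous (R : realType) (X : topologicalType) m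
    (f : X -> 'rV[R]_m) :
  (forall i, continuous (fun x => f x 0 i)) -> continuous f.
Proof.
move=> cf x; apply/cvg_ballP => e e0.
have H : \forall x' \near x, forall i : 'I_m, ball (f x 0 i) e (f x' 0 i).
  apply: filter_forall => i.
  by have /cvg_ballP := cf i x; apply.
by apply: filterS H => x' fx'; split=> // i j; rewrite ord1; exact: fx'.
Qed.

Lemma norm_fun_continuous (R : realType) (X : topologicalType) (f : X -> R) :
  continuous f -> continuous (fun x => `|f x|).
Proof.
move=> cf x.
apply: (@continuous_comp _ _ _ f (fun y : R => `|y|)); first exact: cf.
exact: (@norm_continuous _ R^o).
Qed.

Lemma closed_equalizer (R : realType) (X : topologicalType) (f g : X -> R) :
  continuous f -> continuous g -> closed [set x | f x = g x].
Proof.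
move=> cf cg; have cfg : continuous (fun x => f x - g x).
  by move=> x; apply: (@continuousB _ R^o); [exact: cf|exact: cg].
rewrite (_ : [set x | _] = (fun x => f x - g x) @^-1` [set y : R | y = 0]).
  by move/continuous_closedP : cfg; apply; exact: closed_eq.
apply/seteqP; split=> x /= => [->|/eqP]; first exact: subrr.
by rewrite subr_eq0 => /eqP.
Qed.

(** * The scalar product *)

Definition dot (R : realType) n (y x : 'rV[R]_n) : R := \sum_i y 0 i * x 0 i.

Section Dot.
Variables (R : realType) (n : nat).
Implicit Types x y z : 'rV[R]_n.

Lemma dotDl x y z : dot (x + y) z = dot x z + dot y z.
Proof. by rewrite -big_split; apply: eq_bigr => i _; rewrite mxE mulrDl. Qed.

Lemma dotZl c x y : dot (c *: x) y = c * dot x y.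
Proof. by rewrite mulr_sumr; apply: eq_bigr => i _; rewrite mxE mulrA. Qed.

Lemma dotZr c x y : dot x (c *: y) = c * dot x y.
Proof. by rewrite mulr_sumr; apply: eq_bigr => i _; rewrite mxE mulrCA. Qed.

Lemma dotDr x y z : dot z (x + y) = dot z x + dot z y.
Proof. by rewrite -big_split; apply: eq_bigr => i _; rewrite mxE mulrDr. Qed.

Lemma dot0l x : dot 0 x = 0.
Proof. by rewrite -(scale0r 0) dotZl mul0r. Qed.

Lemma dot0r x : dot x 0 = 0.
Proof. by rewrite -(scale0r 0) dotZr mul0r. Qed.

Lemma dotNl x y : dot (- x) y = - dot x y.
Proof. by rewrite -scaleN1r dotZl mulN1r. Qed.

Lemma dot_sumr (I : finType) x (c : I -> R) (v : I -> 'rV[R]_n) :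
  dot x (\sum_i c i *: v i) = \sum_i c i * dot x (v i).
Proof.
rewrite (big_morph (dot x) (fun y z => dotDr y z x) (dot0r x)).
by apply: eq_bigr => i _; rewrite dotZr.
Qed.

Lemma dot_continuous x : continuous (fun y => dot y x).
Proof.
apply: sumr_fun_continuous => i; apply: mulr_fun_continuous.
  exact: coord_continuous.
exact: cst_continuous.
Qed.

End Dot.

(** The equations say that [a] is supported on the face cut out by [y], where
    [<y, v_k>] is 1 or -1, and that there [<y, v_k>] is the sign of [a_k].  They
    are linear programming certificates: when [|<y, v_k>| <= 1] for all [k], the
    vector [y] proves that no other combination
    of the [v_k] with the same sum has a smaller l1 norm.  As equations they
    also define a closed condition on the pair [(a, y)]. *)
Definition face_certificate (R : realType) n m (v : 'I_m -> 'rV[R]_n)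
    (Y : set 'rV[R]_n) (y : 'rV[R]_n) (a : 'rV[R]_m) : Prop :=
  Y y /\ forall k, a 0 k * dot y (v k) = `|a 0 k|.

(** * From a coherent family of free faces to a triangulation *)

Section Projective.
Variables (R : realType) (d m : nat).
(* [Y] is not the polar body of [v] itself: it will be that of a larger family,
   of which [v] keeps the vectors lying on some face. *)
Variables (v : 'I_m -> 'rV[R]_d.+1) (Y : set 'rV[R]_d.+1).

Definition active_simplices : {set {set 'I_m}} :=
  [set s | (s != finset.set0) &&
     `[< exists2 y, Y y & forall k, k \in s -> `|dot y (v k)| = 1 >]]%SET.

Hypothesis Y_compact : compact Y.
Hypothesis Y_le1 : forall y, Y y -> forall k, `|dot y (v k)| <= 1.
Hypothesis Y_active : forall k, exists2 y, Y y & `|dot y (v k)| = 1.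
Hypothesis Y_free : forall y, Y y -> forall a : 'rV[R]_m,
  (forall k, a 0 k != 0 -> `|dot y (v k)| = 1) ->
  \sum_k a 0 k *: v k = 0 -> a = 0.
Hypothesis Y_span : forall p, p != 0 ->
  exists y a, face_certificate v Y y a /\ p = \sum_k a 0 k *: v k.
Hypothesis Y_coherent : forall y y' i j, Y y -> Y y' ->
  `|dot y (v i)| = 1 -> `|dot y (v j)| = 1 ->
  `|dot y' (v i)| = 1 -> `|dot y' (v j)| = 1 ->
  dot y (v i) * dot y (v j) = dot y' (v i) * dot y' (v j).

Lemma active_neq0 : finset.set0 \notin active_simplices.
Proof. by rewrite inE eqxx. Qed.

Lemma active_vertex i : [set i]%SET \in active_simplices.
Proof.
rewrite inE; apply/andP; split; first by apply/set0Pn; exists i; rewrite inE.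
by apply/asboolP; have [y Yy yi] := Y_active i; exists y => // k /set1P ->.
Qed.

Lemma active_closed (s t : {set 'I_m}) : s \in active_simplices ->
  t \subset s -> t != finset.set0 -> t \in active_simplices.
Proof.
rewrite !inE => /andP[_ /asboolP[y Yy ys]] ts -> /=.
by apply/asboolP; exists y => // k /(fintype.subsetP ts)/ys.
Qed.

Definition active_complex : simplicial_complex m :=
  SimplicialComplex active_neq0 active_vertex active_closed.

Lemma certificate_active y a k :
  face_certificate v Y y a -> a 0 k != 0 -> `|dot y (v k)| = 1.
Proof.
move=> [_ /(_ k)/(congr1 Num.norm)]; rewrite normrM normr_id -normr_eq0.
by move=> ak a0; apply: (mulfI a0); rewrite ak mulr1.
Qed.

Lemma certificate_norm y a : face_certificate v Y y a ->
  dot y (\sum_k a 0 k *: v k) = \sum_k `|a 0 k|.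
Proof. by move=> [_ ya]; rewrite dot_sumr; apply: eq_bigr. Qed.

(** Pairing with [y] computes the l1 norm of [a] and bounds from below that of
    any other combination with the same sum. *)
Lemma certificate_le y a (b : 'rV[R]_m) : face_certificate v Y y a ->
  \sum_k a 0 k *: v k = \sum_k b 0 k *: v k ->
  \sum_k `|a 0 k| <= \sum_k `|b 0 k|.
Proof.
move=> ya ab; rewrite -(certificate_norm ya) ab dot_sumr ler_sum// => k _.
apply: (le_trans (ler_norm _)); rewrite normrM ler_piMr//.
by apply: Y_le1; case: ya.
Qed.

(** By minimality on both sides, [a] and [b] have the same l1 norm, so [y] also
    certifies [b]; both are then supported on the face of [y], where the
    vectors are independent. *)
Lemma certificate_uniq y y' a b :
  face_certificate v Y y a -> face_certificate v Y y' b ->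
  \sum_k a 0 k *: v k = \sum_k b 0 k *: v k -> a = b.
Proof.
move=> ya yb ab.
have yb' : face_certificate v Y y b.
  split; first by case: ya.
  have le_b k : 0 <= `|b 0 k| - b 0 k * dot y (v k).
    rewrite subr_ge0; apply: (le_trans (ler_norm _)).
    by rewrite normrM ler_piMr// Y_le1//; case: ya.
  have sum0 : \sum_k (`|b 0 k| - b 0 k * dot y (v k)) = 0.
    rewrite big_split/= sumrN -dot_sumr -ab (certificate_norm ya).
    apply/eqP; rewrite subr_eq0 eq_le (certificate_le ya ab).
    by rewrite (certificate_le yb (esym ab)).
  move=> k; apply/esym/eqP; rewrite -subr_eq0; apply/eqP.
  exact: (psumr_eq0P (fun k _ => le_b k) sum0).
apply/eqP; rewrite -subr_eq0; apply/eqP; apply: (Y_free (proj1 ya)).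
  move=> k; rewrite !mxE => abk.
  have [a0|] := eqVneq (a 0 k) 0; last exact: certificate_active.
  apply: (certificate_active yb'); apply: contraNneq abk => ->.
  by rewrite a0 subrr.
under eq_bigr do rewrite !mxE scalerBl.
by rewrite sumrB ab subrr.
Qed.

Lemma certificate_coord y a k :
  face_certificate v Y y a -> a 0 k = `|a 0 k| * dot y (v k).
Proof.
move=> ya; have [->|a0] := eqVneq (a 0 k) 0; first by rewrite normr0 mul0r.
rewrite -(proj2 ya k) -mulrA -expr2 -(real_normK (num_real _)).
by rewrite (certificate_active ya a0) expr1n mulr1.
Qed.

(** This is where coherence enters: on the common support, the relative signs
    of the entries are the products [<y, v_i> <y, v_j>], which do not depend on
    the certificate. *)
Lemma certificate_abs_coherent y y' a b : a != 0 ->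
  face_certificate v Y y a -> face_certificate v Y y' b ->
  (forall k, `|a 0 k| = `|b 0 k|) -> exists2 c : R, c != 0 & b = c *: a.
Proof.
move=> a0 ya yb ab.
have [k0 ak0] : exists k, a 0 k != 0.
  apply/existsP; apply: contraNT a0 => /existsPn ak.
  by apply/eqP/rowP => k; rewrite mxE; move: (ak k); rewrite negbK => /eqP.
have bk k : a 0 k != 0 -> b 0 k != 0 by rewrite -normr_eq0 ab normr_eq0.
have sq z w : face_certificate v Y z w -> w 0 k0 != 0 ->
    dot z (v k0) * dot z (v k0) = 1.
  by move=> zw w0; rewrite -expr2 -(real_normK (num_real _)) (certificate_active zw w0) expr1n.
have sqy := sq _ _ ya ak0; have sqy' := sq _ _ yb (bk _ ak0).
(* Coherence with the pair (k0, k) turns the sign of [a_k] into that of [b_k]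
   up to this factor. *)
exists (dot y (v k0) * dot y' (v k0)).
  apply/eqP => c0; have /eqP := oner_neq0 R; apply.
  by rewrite -[LHS]mulr1 -{1}sqy -sqy' mulrACA c0 mul0r.
apply/rowP => k; rewrite mxE (certificate_coord k yb) -ab.
rewrite [in RHS](certificate_coord k ya) mulrCA.
have [->|ak] := eqVneq (a 0 k) 0; first by rewrite normr0 !mul0r.
congr (_ * _); rewrite -mulrA mulrC -mulrA [dot y (v k) * _]mulrC.
rewrite (Y_coherent (y' := y') (proj1 ya) (proj1 yb)); first last.
- exact: certificate_active yb (bk _ ak).
- exact: certificate_active yb (bk _ ak0).
- exact: certificate_active ya ak.
- exact: certificate_active ya ak0.
by rewrite mulrA sqy' mul1r.
Qed.

(** Up to the choice of [y], this is the boundary of the polytope in barycentric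
    coordinates.  Keeping [y] as a component makes compactness immediate, since
    the conditions are closed in the pair. *)
Definition lifted_sphere : set ('rV[R]_m * 'rV[R]_d.+1) :=
  [set g | face_certificate v Y g.2 g.1 /\ \sum_k `|g.1 0 k| = 1].

Lemma lifted_sphere_compact : compact lifted_sphere.
Proof.
pose box := [set a : 'rV[R]_m | forall k, [set` `[(- 1 : R), 1]] (a 0 k)].
have cbox : compact box.
  exact: (@rV_compact R m (fun=> [set` `[(- 1 : R), 1]])
    (fun=> @segment_compact _ _ _)).
pose C1 := [set g : 'rV[R]_m * 'rV[R]_d.+1 | \sum_k `|g.1 0 k| = 1].
pose C2 := \bigcap_k [set g : 'rV[R]_m * 'rV[R]_d.+1 |
  g.1 0 k * dot g.2 (v k) = `|g.1 0 k|].
have fst_coord k : continuous (fun g : 'rV[R]_m * 'rV[R]_d.+1 => g.1 0 k).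
  move=> g; apply: (@continuous_comp _ _ _ _ (fun a : 'rV[R]_m => a 0 k)).
    exact: cvg_fst.
  exact: coord_continuous.
have abs_coord k : continuous (fun g : 'rV[R]_m * 'rV[R]_d.+1 => `|g.1 0 k|).
  exact: norm_fun_continuous.
have cC1 : closed C1.
  apply: closed_equalizer (@cst_continuous _ _ _).
  exact: (sumr_fun_continuous abs_coord).
have cC2 : closed C2.
  apply: closed_bigI => k _; apply: closed_equalizer (abs_coord k).
  apply: (mulr_fun_continuous (fst_coord k)) => g.
  apply: (@continuous_comp _ _ _ _ (fun y => dot y (v k))).
    exact: cvg_snd.
  exact: dot_continuous.
have -> : lifted_sphere = (box `*` Y) `&` (C1 `&` C2).
  apply/seteqP; split=> [[a y] [[/= Yy ya] a1]|[a y] [[/= _ Yy] [/= a1 ya]]].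
    split; last by split=> // k _; exact: ya.
    split=> // k; change (a 0 k \in `[(- 1 : R), 1]).
    rewrite in_itv/= -ler_norml -a1 (bigD1 k)//= lerDl.
    by apply: sumr_ge0 => i _; exact: normr_ge0.
  by split=> //; split=> // k; exact: ya.
apply: compact_closedI; last exact: closedI.
exact: compact_setX.
Qed.

Lemma sphere_barycentric (g : lifted_sphere) :
  (geometric_realization R active_complex) (\row_k `|(\val g).1 0 k|).
Proof.
have [ya a1] := set_valP g; split=> [k||].
- by rewrite mxE normr_ge0.
- by rewrite -[RHS]a1; apply: eq_bigr => k _; rewrite mxE.
rewrite inE; apply/andP; split.
  apply: contra_eq_neq a1 => s0; rewrite big1 ?(eq_sym 0) ?oner_neq0// => k _.
  move/setP : s0 => /(_ k); rewrite !inE mxE => /negbT.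
  by rewrite negbK => /eqP.
apply/asboolP; exists (\val g).2; first exact: (proj1 ya).
move=> k; rewrite inE mxE normr_eq0; exact: certificate_active.
Qed.

Lemma sphere_point (g : lifted_sphere) :
  punctured_space R d (\sum_k (\val g).1 0 k *: v k).
Proof.
have [ya a1] := set_valP g; rewrite /punctured_space/=.
apply/eqP => s0; have := certificate_norm ya.
by rewrite s0 dot0r a1 => /eqP; rewrite eq_sym oner_eq0.
Qed.

Definition to_realization (g : lifted_sphere) :
    geometric_realization R active_complex :=
  to_set_type (sphere_barycentric g).

Definition to_punctured (g : lifted_sphere) : punctured_space R d :=
  to_set_type (sphere_point g).

Definition to_projective (g : lifted_sphere) : real_projective_space R d :=
  (\pi_(real_projective_space R d) (to_punctured g))%qT.

Lemma sphere_coord_continuous k :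
  continuous (fun g : lifted_sphere => (\val g).1 0 k).
Proof.
move=> g; apply: (@continuous_comp _ _ _ _ (fun p : 'rV[R]_m * 'rV[R]_d.+1 => p.1 0 k)).
  exact: initial_continuous.
apply: (@continuous_comp _ _ _ _ (fun a : 'rV[R]_m => a 0 k)).
  exact: cvg_fst.
exact: coord_continuous.
Qed.

Lemma to_realization_continuous : continuous to_realization.
Proof.
apply: continuous_comp_initial; apply: rV_fun_continuous => k.
rewrite (_ : (fun _ => _) = (fun g : lifted_sphere => `|(\val g).1 0 k|)).
  by apply: norm_fun_continuous; exact: sphere_coord_continuous.
by apply/funext => g /=; rewrite mxE.
Qed.

Lemma to_projective_continuous : continuous to_projective.
Proof.
have ct : continuous to_punctured.
  apply: continuous_comp_initial; apply: rV_fun_continuous => i.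
  rewrite (_ : (fun _ => _) =
    (fun g : lifted_sphere => \sum_k (\val g).1 0 k * v k 0 i)).
    apply: sumr_fun_continuous => k; apply: mulr_fun_continuous.
      exact: sphere_coord_continuous.
    exact: cst_continuous.
  by apply/funext => g /=; rewrite summxE; apply: eq_bigr => k _; rewrite mxE.
by move=> g; apply: continuous_comp; [exact: ct|exact: pi_continuous].
Qed.

Lemma to_realization_surj x : exists g, to_realization g = x.
Proof.
have [x0 x1] := set_valP x; rewrite inE => /andP[_ /asboolP[y Yy yx]].
pose a : 'rV[R]_m := \row_k ((\val x) 0 k * dot y (v k)).
have xa k : `|a 0 k| = (\val x) 0 k.
  rewrite mxE normrM (ger0_norm (x0 k)).
  have [->|xk] := eqVneq ((\val x) 0 k) 0; first by rewrite mul0r.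
  by rewrite yx ?mulr1// inE.
have ga : lifted_sphere (a, y).
  split; last by rewrite -[RHS]x1; apply: eq_bigr => k _; rewrite xa.
  split=> // k; rewrite xa mxE -mulrA -expr2 -(real_normK (num_real _)).
  have [->|xk] := eqVneq ((\val x) 0 k) 0; first by rewrite mul0r.
  by rewrite yx ?expr1n ?mulr1// inE.
exists (to_set_type ga); apply/val_inj/rowP => k /=.
by rewrite mxE xa.
Qed.

Lemma to_projective_surj z : exists g, to_projective g = z.
Proof.
rewrite -(reprK z); move: (repr z) => {z} p.
have p0 : \val p != 0 by exact: (set_valP p).
have [y [a [ya pE]]] := Y_span p0.
have s0 : 0 < \sum_k `|a 0 k|.
  rewrite lt_neqAle sumr_ge0 ?andbT// eq_sym.
  apply: contra p0 => /eqP s0; apply/eqP; rewrite pE big1// => k _.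
  rewrite (_ : a 0 k = 0) ?scale0r//; apply/normr0_eq0.
  exact: (psumr_eq0P (fun k _ => normr_ge0 _) s0).
set s := \sum_k `|a 0 k| in s0.
have gs : lifted_sphere (s^-1 *: a, y).
  have si0 : 0 <= s^-1 by rewrite invr_ge0 ltW.
  split; last first.
    rewrite -[RHS](mulVf (lt0r_neq0 s0)) mulr_sumr; apply: eq_bigr => k _ /=.
    by rewrite mxE normrM ger0_norm.
  split=> /=; first by case: ya.
  by move=> k; rewrite mxE -mulrA (proj2 ya) normrM ger0_norm.
exists (to_set_type gs); apply/eq_projectiveP; exists s.
  by rewrite gt_eqF.
rewrite /= pE scaler_sumr; apply: eq_bigr => k _.
by rewrite mxE scalerA mulrA mulfV ?mul1r// gt_eqF.
Qed.

Hypothesis Y_opp : forall y, Y y -> Y (- y).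

Lemma certificateZ y a (c : R) : face_certificate v Y y a ->
  exists y', face_certificate v Y y' (c *: a).
Proof.
move=> [Yy ya]; have [c0|c0] := leP 0 c.
  by exists y; split=> // k; rewrite mxE -mulrA ya normrM ger0_norm.
exists (- y); split=> [|k]; first exact: Y_opp.
by rewrite mxE dotNl mulrN -mulrA ya normrM ltr0_norm// mulNr.
Qed.

(** Equal absolute values give proportional coordinates by coherence; equal
    lines give proportional coordinates by uniqueness, with a factor of
    absolute value 1 because of the normalisation. *)
Lemma sphere_fibers g g' :
  to_realization g = to_realization g' <-> to_projective g = to_projective g'.
Proof.
have [ya a1] := set_valP g; have [yb b1] := set_valP g'.
split=> [/(congr1 val) /rowP gg'|/eq_projectiveP[c c0 gg']].
  have a0 : (\val g).1 != 0.
    apply/eqP => a0; move: a1; rewrite big1 => [/eqP|k _].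
      by rewrite eq_sym oner_eq0.
    by rewrite a0 mxE normr0.
  have [|c c0 ab] := certificate_abs_coherent a0 ya yb.
    by move=> k; have := gg' k; rewrite !mxE.
  apply/eq_projectiveP; exists c => //=; rewrite ab scaler_sumr.
  by apply: eq_bigr => k _; rewrite mxE scalerA.
have [y' yca] := certificateZ c ya.
have ab : (\val g').1 = c *: (\val g).1.
  apply: (certificate_uniq yb yca); rewrite [LHS]gg' /= scaler_sumr.
  by apply: eq_bigr => k _; rewrite mxE scalerA.
have c1 : `|c| = 1.
  rewrite -b1 ab -[LHS]mulr1 -a1 mulr_sumr; apply: eq_bigr => k _.
  by rewrite mxE normrM.
apply/val_inj/rowP => k; rewrite !mxE ab mxE normrM c1 mul1r//.
Qed.

Theorem active_complex_triangulates :
  triangulates R active_complex (real_projective_space R d).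
Proof.
apply: (compact_quotients_homeomorphic
  (compact_set_type lifted_sphere_compact)
  (@hausdorff_set_type _ _ _) (@rp_hausdorff R d)
  to_realization_continuous to_projective_continuous
  to_realization_surj to_projective_surj sphere_fibers).
Qed.

End Projective.

(** * Faces of a spanning family through its polar body *)

Section Polar.
Variables (R : realType) (n M : nat).
Implicit Types v : 'I_M -> 'rV[R]_n.

Definition polar v : set 'rV[R]_n := [set y | forall k, `|dot y (v k)| <= 1].

Definition spanning v := forall p, exists a : 'rV[R]_M, p = \sum_k a 0 k *: v k.

Definition faces_free v := forall y, polar v y -> forall a : 'rV[R]_M,
  (forall k, a 0 k != 0 -> `|dot y (v k)| = 1) ->
  \sum_k a 0 k *: v k = 0 -> a = 0.

Definition faces_coherent v := forall y y' i j, polar v y -> polar v y' ->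
  `|dot y (v i)| = 1 -> `|dot y (v j)| = 1 ->
  `|dot y' (v i)| = 1 -> `|dot y' (v j)| = 1 ->
  dot y (v i) * dot y (v j) = dot y' (v i) * dot y' (v j).

Lemma polar0 v : polar v 0.
Proof. by move=> k; rewrite dot0l normr0 ler01. Qed.

Lemma polarZ v (c : R) y : `|c| <= 1 -> polar v y -> polar v (c *: y).
Proof. by move=> c1 vy k; rewrite dotZl normrM mulr_ile1. Qed.

Lemma polarN v y : polar v y -> polar v (- y).
Proof. by move=> vy k; rewrite dotNl normrN. Qed.

Lemma polar_compact v : spanning v -> compact (polar v).
Proof.
move=> vs.
have vb j : exists B : R, forall y, polar v y -> `|y 0 j| <= B.
  have [a aE] := vs (delta_mx 0 j); exists (\sum_k `|a 0 k|) => y vy.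
  have -> : y 0 j = dot y (delta_mx 0 j).
    rewrite /dot (bigD1 j)//= mxE !eqxx mulr1 big1 ?addr0// => i ij.
    by rewrite mxE (negPf ij) andbF mulr0.
  rewrite aE dot_sumr; apply: (le_trans (ler_norm_sum _ _ _)).
  by apply: ler_sum => k _; rewrite normrM ler_piMr.
have [B HB] := choice vb.
apply: (subclosed_compact (B := [set y : 'rV[R]_n |
    forall j, [set` `[- B j, B j]] (y 0 j)])).
- rewrite (_ : polar v = \bigcap_k [set y | `|dot y (v k)| <= 1]); last first.
    by apply/seteqP; split=> y vy k; [move=> _|]; apply: vy.
  apply: closed_bigI => k _.
  have /continuous_closedP := norm_fun_continuous (@dot_continuous _ _ (v k)).
  by move=> /(_ [set x | x <= 1]); apply; exact: closed_le.
- exact: (@rV_compact R n (fun j => [set` `[- B j, B j]])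
    (fun=> @segment_compact _ _ _)).
- move=> y vy j; change (y 0 j \in `[- B j, B j]).
  by rewrite in_itv/= -ler_norml HB.
Qed.

(** The linear alternative: a vector outside of a span is detected by a linear
    form that vanishes on the span.  It replaces Farkas' lemma below, thanks to
    the independence of the faces. *)
Lemma span_or_separate v (u : 'rV[R]_n) :
  (exists a : 'rV[R]_M, u = \sum_k a 0 k *: v k) \/
  exists2 z, (forall k, dot z (v k) = 0) & 0 < dot z u.
Proof.
pose A : 'M[R]_(M, n) := \matrix_(k < M) v k.
have [/submxP[a uE]|] := boolP (u <= A)%MS.
  left; exists a; rewrite uE mulmx_sum_row.
  by apply: eq_bigr => k _; rewrite rowK.
rewrite submxE => uA; right.
have [j uj] : exists j, (u *m cokermx A) 0 j != 0.
  apply/existsP; apply: contraNT uA => /existsPn uA.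
  by apply/eqP/rowP => j; rewrite [RHS]mxE; move: (uA j); rewrite negbK => /eqP.
have dotE (x : 'rV[R]_n) : dot (col j (cokermx A))^T x = (x *m cokermx A) 0 j.
  by rewrite mxE; apply: eq_bigr => i _; rewrite !mxE mulrC.
exists (Num.sg ((u *m cokermx A) 0 j) *: (col j (cokermx A))^T).
  move=> k; rewrite dotZl dotE -[v k](rowK v) -/A -row_mul.
  by rewrite mulmx_coker !mxE mulr0.
by rewrite dotZl dotE -normrEsg normr_gt0.
Qed.

(** First-order optimality of a maximiser [y] of [<., p>] on the polar body: a
    direction [z] that does not violate the constraints active at [y] can be
    followed for a short time, so [<z, p>] cannot be positive. *)
Lemma polar_ascent v y z p : polar v y ->
  (forall y', polar v y' -> dot y' p <= dot y p) ->
  (forall k, `|dot y (v k)| = 1 -> dot z (v k) * dot y (v k) <= 0) ->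
  dot z p <= 0.
Proof.
move=> vy ymax zy; rewrite leNgt; apply/negP => zp.
have /filter_ex[e [e0 ve]] : \forall e \near (0 : R)^'+,
    0 < e /\ forall k, `|dot y (v k) + e * dot z (v k)| <= 1.
  near=> e; split; first by [].
  near: e; apply: filter_forall => k.
  set s := dot y (v k); set t := dot z (v k).
  have t1 : 0 < `|t| + 1 by rewrite ltr_wpDl.
  have [s1|s1] := eqVneq `|s| 1.
    have ts : t * s <= 0 by exact: zy.
    near=> e; have e0 : 0 < e by [].
    have et : e * `|t| <= 2.
      apply: (@le_trans _ _ (e * (`|t| + 1))).
        by rewrite ler_wpM2l ?(ltW e0)// lerDl.
      by rewrite -ler_pdivlMr// ltW//; near: e; apply: nbhs_right_lt; rewrite divr_gt0.
    have : (s == 1) || (s == -1) by move: (eqr_norml s 1); rewrite s1 eqxx ler01 andbT => <-.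
    move=> /orP[]/eqP sE; move: ts; rewrite sE ?mulr1 ?mulrN1 ?oppr_le0 => t0.
      rewrite ler_norml; move: et; rewrite ler0_norm// => et; nra.
    rewrite ler_norml; move: et; rewrite ger0_norm// => et; nra.
  have s2 : `|s| < 1 by rewrite lt_neqAle s1; exact: vy.
  near=> e; have e0 : 0 < e by [].
  apply: (le_trans (ler_normD _ _)); rewrite normrM (gtr0_norm e0).
  rewrite -lerBrDl; apply: (@le_trans _ _ (e * (`|t| + 1))).
    by rewrite ler_wpM2l ?(ltW e0)// lerDl.
  rewrite -ler_pdivlMr// ltW//; near: e; apply: nbhs_right_lt.
  by rewrite divr_gt0// subr_gt0.
have := ymax (y + e *: z); rewrite dotDl dotZl gerDl.
rewrite leNgt pmulr_rgt0// zp => /(_ _)/negP; apply=> // k.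
by rewrite dotDl dotZl.
Unshelve. all: by end_near. Qed.

(** Take [y] maximising [<., p>] on the polar body.  If [p] were not a
    combination of the active vectors, a form vanishing on them and positive at
    [p] would contradict [polar_ascent].  If some coefficient had the wrong
    sign, so would a form that vanishes on all active vectors but that one,
    which exists since the active vectors are independent. *)
Lemma polar_certificate v p : spanning v -> faces_free v ->
  exists y (a : 'rV[R]_M), face_certificate v (polar v) y a /\
    p = \sum_k a 0 k *: v k.
Proof.
move=> vs vf.
have [||y yv ymax] := compact_EVT_max (f := fun y => dot y p) _ (polar_compact vs).
- by exists 0; exact: polar0.
- by apply: continuous_subspaceT; exact: dot_continuous.
move: yv; rewrite inE => yv.
have {}ymax y' : polar v y' -> dot y' p <= dot y p.
  by move=> vy'; apply: ymax; rewrite inE.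
(* Inactive vectors are replaced by 0 rather than removed, to keep the index
   type. *)
pose act k := `|dot y (v k)| == 1.
have [[a0 pE]|[z zv zp]] := span_or_separate (fun k => if act k then v k else 0) p;
    last first.
  have := polar_ascent yv ymax (z := z); rewrite leNgt zp => /(_ _) H.
  suff // : false by []; apply: H => k /eqP yk.
  by move: (zv k); rewrite /act yk => ->; rewrite mul0r.
pose a : 'rV[R]_M := \row_k (if act k then a0 0 k else 0).
have {}pE : p = \sum_k a 0 k *: v k.
  rewrite pE; apply: eq_bigr => k _; rewrite mxE; case: ifP => //.
  by rewrite scaler0 scale0r.
exists y, a; split=> //; split=> // k.
have [ak|/negPf ak] := boolP (act k); last by rewrite mxE ak mul0r normr0.
suff ge0 : 0 <= a 0 k * dot y (v k).
  by rewrite -(ger0_norm ge0) normrM (eqP ak) mulr1.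
rewrite leNgt; apply/negP => lt0.
have [[b vkE]|[z zv zk]] :=
    span_or_separate (fun i => if act i && (i != k) then v i else 0) (v k).
  (* [v k] in the span of the other active vectors is a dependency. *)
  pose c : 'rV[R]_M := \row_i (if i == k then -1 else if act i then b 0 i else 0).
  have c0 : c = 0.
    apply: (vf y yv) => [i|].
      rewrite mxE; have [->|ik] := eqVneq i k; first by move=> _; exact/eqP.
      by case: ifP => [/eqP//|]; rewrite eqxx.
    rewrite (bigD1 k)//= mxE eqxx scaleN1r {1}vkE addrC; apply/eqP.
    rewrite subr_eq0 [eqbRHS](bigD1 k)//= eqxx andbF scaler0 add0r; apply/eqP.
    apply: eq_bigr => i ik; rewrite mxE (negPf ik) andbT; case: ifP => //.
    by rewrite scaler0 scale0r.
  by move/rowP : c0 => /(_ k)/eqP; rewrite !mxE eqxx oppr_eq0 oner_eq0.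
have yk2 : dot y (v k) * dot y (v k) = 1.
  by rewrite -expr2 -(real_normK (num_real _)) (eqP ak) expr1n.
have zv' i : act i -> i != k -> dot z (v i) = 0.
  by move=> ai ik; have := zv i; rewrite ai ik.
have := polar_ascent yv ymax (z := - dot y (v k) *: z).
rewrite leNgt pE dot_sumr (bigD1 k)//= big1 ?addr0 => [|i ik]; last first.
  rewrite mxE; case: ifP => ai; last by rewrite mul0r.
  by rewrite dotZl zv' ?mulr0.
rewrite dotZl mulrA mulrN mulNr oppr_gt0 pmulr_llt0// lt0 => /(_ _) H.
suff // : false by []; apply: H => i /eqP ai.
have [->|ik] := eqVneq i k; last by rewrite dotZl zv'// mulr0 mul0r.
by rewrite dotZl mulrAC mulNr yk2 mulN1r oppr_le0 ltW.
Qed.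

End Polar.

(** Vectors that lie on no face are not vertices, so the complex is built on the
    indices that are active for some [y]; hence only an upper bound on the
    number of vertices. *)
Lemma triangulation_of_free_family (R : realType) d M
    (v : 'I_M -> 'rV[R]_d.+1) :
  spanning v -> faces_free v -> faces_coherent v ->
  exists (m : nat) (K : simplicial_complex m),
    triangulates R K (real_projective_space R d) /\ (m <= M)%N.
Proof.
move=> vs vf vc.
pose act : {set 'I_M} := [set k | `[< exists2 y, polar v y & `|dot y (v k)| = 1 >]]%SET.
pose u : 'I_#|act| -> 'I_M := enum_val.
have uact k : exists2 y, polar v y & `|dot y (v (u k))| = 1.
  by have := enum_valP k; rewrite inE => /asboolP.
have u_le1 y : polar v y -> forall k, `|dot y (v (u k))| <= 1 by move=> vy k; exact: vy.
have u_free y : polar v y -> forall a : 'rV[R]_#|act|,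
    (forall k, a 0 k != 0 -> `|dot y (v (u k))| = 1) ->
    \sum_k a 0 k *: v (u k) = 0 -> a = 0.
  move=> vy a ya a0.
  (* [b] extends [a] by zero to the indices that lie on no face. *)
  pose b : 'rV[R]_M := \row_i \sum_(k | u k == i) a 0 k.
  have bu k : b 0 (u k) = a 0 k.
    rewrite mxE (big_pred1 k)// => k'.
    by rewrite /= (inj_eq enum_val_inj).
  have b0 : b = 0.
    apply: (vf y vy) => [i|].
      have [k /eqP <-|uk] := pickP (fun k => u k == i).
        by rewrite bu; exact: ya.
      by rewrite mxE big_pred0 ?eqxx.
    rewrite -[RHS]a0 (partition_big u xpredT)//=; apply: eq_bigr => i _.
    by rewrite mxE scaler_suml; apply: eq_bigr => k /eqP ->.
  by apply/rowP => k; rewrite -bu b0 !mxE.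
have u_span (p : 'rV[R]_d.+1) : p != 0 -> exists y (a : 'rV[R]_#|act|),
    face_certificate (v \o u) (polar v) y a /\ p = \sum_k a 0 k *: v (u k).
  move=> _; have [y [a [ya pE]]] := polar_certificate p vs vf.
  exists y, (\row_k a 0 (u k)); split.
    by split; [exact: (proj1 ya)|move=> k; rewrite mxE; exact: (proj2 ya)].
  rewrite pE (bigID (mem act))/= [X in _ + X]big1 ?addr0.
    rewrite big_enum_val; apply: eq_bigr => k _.
    by rewrite mxE.
  move=> i; rewrite inE => /asboolPn iact.
  have [->|ai] := eqVneq (a 0 i) 0; first by rewrite scale0r.
  case: iact; exists y; first exact: (proj1 ya).
  exact: certificate_active ya ai.
exists #|act|, (active_complex uact); split; last first.
  by rewrite -[leqRHS]card_ord; exact: max_card.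
apply: active_complex_triangulates => //.
- exact: polar_compact.
- by move=> y y' i j; exact: vc.
- exact: polarN.
Qed.

(** * Rescaling a coherent family to make its faces free *)

Lemma poly_neq0_near_right (R : realType) (P : {poly R}) :
  P != 0 -> \forall t \near (0 : R)^'+, P.[t] != 0.
Proof.
move=> P0; have [k [Q]] := multiplicity_XsubC P 0.
rewrite P0 /= subr0 => Q0 PE.
have Qn : \forall t \near (0 : R)^'+, Q.[t] != 0.
  apply: (@cvgr_neq0 _ R^o _ _ _ (horner Q) Q.[0]) => //.
  exact/cvg_at_right_filter/continuous_horner.
near=> t; rewrite PE hornerM hornerXn mulf_neq0//; first by near: t.
by rewrite expf_neq0// gt_eqF.
Unshelve. all: by end_near. Qed.

Section Perturbation.
Variables (R : realType) (n M : nat) (v : 'I_M -> 'rV[R]_n).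
Hypothesis v_spanning : spanning v.

Definition rescale (x : 'I_M -> R) (k : 'I_M) : 'rV[R]_n := x k *: v k.

Lemma rescale_spanning x : (forall k, x k != 0) -> spanning (rescale x).
Proof.
move=> x0 p; have [a ->] := v_spanning p.
exists (\row_k (a 0 k / x k)); apply: eq_bigr => k _.
by rewrite mxE scalerA divfK.
Qed.

(** If [v i] and [v j] (with the sign [b]) lie on no common face, then the
    maximum on the compact polar body of [<y, v_i> + (-1)^b <y, v_j>] is less
    than 2, which leaves room for a small rescaling. *)
Lemma rescale_pair_near i j (b : bool) : \forall t \near (0 : R)^'+,
  forall x, (forall k, (1 + t)^-1 <= x k <= 1) ->
  forall y, polar (rescale x) y ->
    dot y (rescale x i) = 1 -> dot y (rescale x j) = (-1) ^+ b ->
  exists2 y', polar v y' & dot y' (v i) = 1 /\ dot y' (v j) = (-1) ^+ b.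
Proof.
set s : R := (-1) ^+ b; have s2 : s * s = 1 by rewrite -expr2 sqrr_sign.
have s1 : `|s| = 1 by rewrite normr_sign.
pose f y := dot y (v i + s *: v j).
have fE y : f y = dot y (v i) + s * dot y (v j) by rewrite /f dotDr dotZr.
have [||y0 y0v fmax] := compact_EVT_max (f := f) _ (polar_compact v_spanning).
- by exists 0; exact: polar0.
- by apply: continuous_subspaceT; exact: dot_continuous.
move: y0v; rewrite inE => y0v.
have {}fmax y' : polar v y' -> f y' <= f y0.
  by move=> vy'; apply: fmax; rewrite inE.
have f0 : 0 <= f y0 by have := fmax 0 (polar0 v); rewrite /f dot0l.
have [f2|f2] := leP 2 (f y0).
  near=> t => x xk y _ _ _; exists y0 => //.
  have vi : dot y0 (v i) <= 1 by exact: le_trans (ler_norm _) (y0v i).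
  have vj : s * dot y0 (v j) <= 1.
    by apply: (le_trans (ler_norm _)); rewrite normrM s1 mul1r.
  have [vi1 vj1] : dot y0 (v i) = 1 /\ s * dot y0 (v j) = 1.
    by move: f2 vi vj; rewrite fE => *; split; lra.
  by split=> //; rewrite -[LHS]mul1r -s2 -mulrA vj1 mulr1.
near=> t => x xk y yx yi yj; exfalso.
have t0 : 0 < t by [].
have tf : (1 + t) * f y0 < 2.
  have : t * (f y0 + 1) < 2 - f y0.
    rewrite -ltr_pdivlMr ?ltr_wpDl//; near: t; apply: nbhs_right_lt.
    by rewrite divr_gt0 ?subr_gt0// ltr_wpDl.
  by nra.
have x0 k : 0 < x k by case/andP: (xk k) => + _; apply: lt_le_trans; rewrite invr_gt0 ltr_wpDl.
have xV k : 1 <= (x k)^-1 <= 1 + t.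
  have /andP[x1 x2] := xk k; rewrite -[X in X <= _ <= _]invr1 lef_pV2 ?posrE// x2/=.
  by rewrite -[leRHS]invrK lef_pV2// posrE// invr_gt0 ltr_wpDl.
have vE k : dot y (v k) = (x k)^-1 * dot y (rescale x k).
  by rewrite dotZr mulKf// gt_eqF.
have t1 : 0 < 1 + t by rewrite ltr_wpDl.
(* Dividing by 1 + t brings y back to the polar body of v. *)
have /fmax : polar v ((1 + t)^-1 *: y).
  have tV0 : 0 <= (1 + t)^-1 by rewrite invr_ge0 ltW.
  have xV0 k : 0 <= (x k)^-1 by rewrite invr_ge0 ltW.
  move=> k; rewrite dotZl normrM ger0_norm// ler_pdivrMl// mulr1.
  rewrite vE normrM; have /andP[_ x2] := xV k.
  by apply: le_trans x2; rewrite ger0_norm// ler_piMr.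
rewrite leNgt => /negP; apply; rewrite (fE (_ *: _)) !dotZl mulrCA -mulrDr.
rewrite ltr_pdivlMl// (lt_le_trans tf)// !vE yi yj [_ * (-1) ^+ b]mulrC mulrA s2.
have /andP[] := xV i; have /andP[] := xV j; lra.
Unshelve. all: by end_near. Qed.

(** Up to the sign of [y], any two vertices of a face satisfy the hypotheses of
    [rescale_pair_near], so that the relative signs seen on faces after a small
    rescaling were already seen before. *)
Lemma rescale_coherent_near : faces_coherent v -> \forall t \near (0 : R)^'+,
  forall x, (forall k, (1 + t)^-1 <= x k <= 1) -> faces_coherent (rescale x).
Proof.
move=> vc.
have : \forall t \near (0 : R)^'+, forall q : 'I_M * 'I_M * bool,
    forall x, (forall k, (1 + t)^-1 <= x k <= 1) ->
    forall y, polar (rescale x) y ->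
    dot y (rescale x q.1.1) = 1 -> dot y (rescale x q.1.2) = (-1) ^+ q.2 ->
    exists2 y', polar v y' &
      dot y' (v q.1.1) = 1 /\ dot y' (v q.1.2) = (-1) ^+ q.2.
  by apply: filter_forall => -[[i j] b]; exact: rescale_pair_near.
apply: filterS => t tP x xt.
have norm1 (r : R) : `|r| = 1 -> exists b : bool, r = (-1) ^+ b.
  move=> /eqP; rewrite eqr_norml ler01 andbT => /orP[]/eqP ->.
    by exists false.
  by exists true; rewrite expr1.
have red y i j : polar (rescale x) y ->
    `|dot y (rescale x i)| = 1 -> `|dot y (rescale x j)| = 1 ->
    exists2 y', polar v y' & [/\ `|dot y' (v i)| = 1, `|dot y' (v j)| = 1 &
      dot y' (v i) * dot y' (v j) = dot y (rescale x i) * dot y (rescale x j)].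
  move=> yx /norm1[b bE] /norm1[c cE].
  have [|||y' y'v [yi yj]] := tP (i, j, b (+) c) x xt ((-1) ^+ b *: y).
  - by apply: polarZ; rewrite ?normr_sign.
  - by rewrite dotZl bE -expr2 sqrr_sign.
  - by rewrite dotZl cE signr_addb.
  exists y' => //; rewrite /= in yi yj; rewrite yi yj bE cE.
  by rewrite normr1 normr_sign mul1r signr_addb.
move=> y y' i j yx yx' yi yj yi' yj'.
have [z zv [zi zj <-]] := red _ _ _ yx yi yj.
have [z' zv' [zi' zj' <-]] := red _ _ _ yx' yi' yj'.
exact: vc.
Qed.

(** The inverses of these factors are polynomials in [t] in which each index
    owns a monomial, so no nontrivial signed combination of them vanishes
    identically. *)
Definition geometric_scale (t : R) (k : 'I_M) : R := (1 + t ^+ k.+1)^-1.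

(** A face with support [s] and signs [e] in the rescaled family would force the
    last sum to vanish for every dependency [a] supported on [s]. *)
Lemma sign_vector_near (s : {set 'I_M}) (e : {ffun 'I_M -> bool}) :
  \forall t \near (0 : R)^'+,
  (exists a : 'rV[R]_M, [/\ a != 0, forall k, a 0 k != 0 -> k \in s &
     \sum_k a 0 k *: v k = 0]) ->
  exists a : 'rV[R]_M, [/\ forall k, a 0 k != 0 -> k \in s,
    \sum_k a 0 k *: v k = 0 &
    \sum_k a 0 k * (-1) ^+ e k * (1 + t ^+ k.+1) != 0].
Proof.
have [[a [a0 ae av]]|ndep] := pselect (exists a : 'rV[R]_M,
    [/\ a != 0, forall k, a 0 k != 0 -> k \in s & \sum_k a 0 k *: v k = 0]);
  last by near=> t.
pose P : {poly R} := \sum_k (a 0 k * (-1) ^+ e k) *: (1 + 'X^(k.+1)).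
have P0 : P != 0.
  have [k ak] : exists k, a 0 k != 0.
    apply/existsP; apply: contraNT a0 => /existsPn ak.
    by apply/eqP/rowP => k; rewrite mxE; move: (ak k); rewrite negbK => /eqP.
  apply/eqP => /(congr1 (fun p : {poly R} => p`_k.+1)).
  rewrite coef0 coef_sum (bigD1 k)//= coefZ coefD coef1 coefXn eqxx add0r mulr1.
  rewrite big1 ?addr0 => [/eqP|i ik].
    by rewrite mulf_eq0 (negPf ak) signr_eq0.
  by rewrite coefZ coefD coef1 coefXn eqSS [k == i :> nat]eq_sym val_eqE (negPf ik) addr0 mulr0.
have := poly_neq0_near_right P0; apply: filterS => t Pt _.
exists a; split=> //; move: Pt; rewrite horner_sum.
by under eq_bigr do rewrite hornerZ hornerD hornerC hornerXn.
Unshelve. all: by end_near. Qed.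

Lemma geometric_scale_free_near :
  \forall t \near (0 : R)^'+, faces_free (rescale (geometric_scale t)).
Proof.
have : \forall t \near (0 : R)^'+,
    forall se : {set 'I_M} * {ffun 'I_M -> bool},
    (exists a : 'rV[R]_M, [/\ a != 0, forall k, a 0 k != 0 -> k \in se.1 &
       \sum_k a 0 k *: v k = 0]) ->
    exists a : 'rV[R]_M, [/\ forall k, a 0 k != 0 -> k \in se.1,
      \sum_k a 0 k *: v k = 0 &
      \sum_k a 0 k * (-1) ^+ se.2 k * (1 + t ^+ k.+1) != 0].
  by apply: filter_forall => -[s e]; exact: sign_vector_near.
move=> H; apply: filterS2 H (nbhs_right_gt 0) => t tP t0 y yx a ya av.
have x0 k : 0 < 1 + t ^+ k.+1 by rewrite ltr_wpDl// ?exprn_gt0.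
have gs0 k : geometric_scale t k != 0 by rewrite invr_neq0 ?gt_eqF.
have [//|a0] := eqVneq a 0; exfalso.
pose s : {set 'I_M} := [set k | `|dot y (rescale (geometric_scale t) k)| == 1]%SET.
pose e : {ffun 'I_M -> bool} := [ffun k => dot y (rescale (geometric_scale t) k) < 0].
have [|b [bs bv /eqP]] := tP (s, e).
  exists (\row_k (a 0 k * geometric_scale t k)); split.
  - apply: contra a0 => /eqP/rowP a0; apply/eqP/rowP => k.
    have /eqP := a0 k; rewrite !mxE mulf_eq0 (negPf (gs0 k)) orbF.
    by move/eqP.
  - move=> k; rewrite mxE mulf_eq0 negb_or => /andP[ak _].
    by rewrite inE; apply/eqP; exact: ya.
  - by rewrite -[RHS]av; apply: eq_bigr => k _; rewrite mxE scalerA.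
apply; rewrite /= -[RHS](dot0r y) -bv dot_sumr; apply: eq_bigr => k _.
have [->|bk] := eqVneq (b 0 k) 0; first by rewrite !mul0r.
have := bs k bk; rewrite inE => /eqP yk.
rewrite -mulrA; congr (_ * _); rewrite ffunE.
have -> : dot y (v k) = (1 + t ^+ k.+1) * dot y (rescale (geometric_scale t) k).
  by rewrite dotZr mulVKf// gt_eqF.
rewrite mulrC; congr (_ * _).
by rewrite [RHS]realEsign ?num_real// yk mulr1.
Qed.

Lemma coherent_perturbation : faces_coherent v ->
  exists w : 'I_M -> 'rV[R]_n,
    [/\ spanning w, faces_free w & faces_coherent w].
Proof.
move=> vc.
have [t [[tc tf] [t0 t1]]] : exists t : R, (( forall x,
    (forall k, (1 + t)^-1 <= x k <= 1) -> faces_coherent (rescale x)) /\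
    faces_free (rescale (geometric_scale t))) /\ 0 < t /\ t < 1.
  apply: (@filter_ex _ (0 : R)^'+); near=> t; split; split.
  - by near: t; exact: rescale_coherent_near.
  - by near: t; exact: geometric_scale_free_near.
  - by [].
  - by near: t; exact: nbhs_right_lt.
have tk k : 0 < 1 + t ^+ k.+1 by rewrite ltr_wpDl// ?exprn_gt0.
exists (rescale (geometric_scale t)); split=> //.
  by apply: rescale_spanning => k; rewrite invr_neq0 ?gt_eqF.
apply: tc => k; apply/andP; split.
  have tp : 0 < 1 + t by rewrite ltr_wpDl.
  rewrite /geometric_scale lef_pV2 ?posrE// lerD2l exprS ler_piMr ?(ltW t0)//.
  by rewrite exprn_ile1// ltW.
by rewrite invf_le1// lerDl exprn_ge0// ltW.
Unshelve. all: by end_near. Qed.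

End Perturbation.

Theorem triangulation_of_family (R : realType) d M (v : 'I_M -> 'rV[R]_d.+1) :
  spanning v -> faces_coherent v ->
  exists (m : nat) (K : simplicial_complex m),
    triangulates R K (real_projective_space R d) /\ (m <= M)%N.
Proof.
move=> vs vc; have [w [ws wf wc]] := coherent_perturbation vs vc.
exact: triangulation_of_free_family ws wf wc.
Qed.

(** * A coherent family indexed by transversals of a grid *)

Section Grid.
Variables (R : realType) (q : nat).
Implicit Types (y : 'I_q -> 'I_q -> R) (b r c : 'I_q).

Notation pattern := {ffun 'I_q -> option bool}.
Notation transversal := {ffun 'I_q -> 'I_q * bool}.

(** A special row, a signed set of columns for it, and a signed column for each
    row.  The value of the transversal at the special row is overridden, which
    keeps the index set a plain product. *)
Definition grid_index : finType := ('I_q * pattern * transversal)%type.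

Implicit Types (s : pattern) (f : transversal) (t : grid_index).

Definition entry_sign (o : option bool) : R := if o is Some e then (-1) ^+ e else 0.

Definition pattern_size s : nat := \sum_c (s c != None).

Definition grid_vector t r c : R :=
  let: (b, s, f) := t in
  if r == b then (1 + (pattern_size s)%:R^-1) * entry_sign (s c)
  else if c == (f r).1 then (-1) ^+ (f r).2 else 0.

Definition pairing y t : R := \sum_r \sum_c y r c * grid_vector t r c.

Definition pattern_sum y b s : R := \sum_c y b c * entry_sign (s c).

Definition pattern_value y b s : R :=
  (1 + (pattern_size s)%:R^-1) * pattern_sum y b s.

Definition choice_value y r (p : 'I_q * bool) : R := y r p.1 * (-1) ^+ p.2.

Lemma pairingE y b s f :
  pairing y (b, s, f) = pattern_value y b s + \sum_(r | r != b) choice_value y r (f r).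
Proof.
rewrite /pairing (bigD1 b)//=; congr (_ + _).
  rewrite /pattern_value /pattern_sum mulr_sumr; apply: eq_bigr => c _.
  by rewrite eqxx mulrCA.
apply: eq_bigr => r rb; rewrite (bigD1 (f r).1)//= (negPf rb) eqxx big1 ?addr0//.
by move=> c /negPf ->; rewrite mulr0.
Qed.

Lemma choice_value_abs y r c : exists e, choice_value y r (c, e) = `|y r c|.
Proof.
exists (y r c < 0); rewrite /choice_value/= {1}[y r c]realEsign ?num_real//.
by rewrite mulrAC -signr_addb addbb mul1r.
Qed.

(** Optimality of a grid vector is exploited by changing a single entry. *)
Definition set_entry s c (o : option bool) : pattern :=
  [ffun c' => if c' == c then o else s c'].

Lemma set_entry_size s c o :
  (pattern_size (set_entry s c o) + (s c != None) = pattern_size s + (o != None))%N.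
Proof.
rewrite /pattern_size (bigD1 c)//= [in RHS](bigD1 c)//= ffunE eqxx.
rewrite (eq_bigr (fun c' => (s c' != None) : nat)) => [|c' /negPf c'c].
  by rewrite addnC -addnA; congr addn; rewrite addnC.
by rewrite ffunE c'c.
Qed.

Lemma set_entry_sum y b s c o :
  pattern_sum y b (set_entry s c o) =
  pattern_sum y b s - y b c * entry_sign (s c) + y b c * entry_sign o.
Proof.
rewrite /pattern_sum (bigD1 c)//= [in RHS](bigD1 c)//= ffunE eqxx.
rewrite (eq_bigr (fun c' => y b c' * entry_sign (s c'))) => [|c' /negPf c'c].
  by ring.
by rewrite ffunE c'c.
Qed.

Lemma pattern_sum_size y b s : 0 < pattern_sum y b s -> (0 < pattern_size s)%N.
Proof.
move=> s0; rewrite lt0n; apply: contraTN s0 => /eqP/eqP.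
rewrite /pattern_size sum_nat_eq0 => /forallP sN.
rewrite -leNgt /pattern_sum big1// => c _; move: (sN c) => /=.
by case: (s c) => //= _; rewrite mulr0.
Qed.

Section Optimal.
Variable y : 'I_q -> 'I_q -> R.
Hypothesis y_le1 : forall t, pairing y t <= 1.

Section OneVertex.
Variables (b : 'I_q) (s : pattern) (f : transversal).
Hypothesis y_eq1 : pairing y (b, s, f) = 1.

Lemma optimal_pattern s' : pattern_value y b s' <= pattern_value y b s.
Proof. by have := y_le1 (b, s', f); rewrite -y_eq1 !pairingE lerD2r. Qed.

Lemma optimal_choice r p : r != b -> choice_value y r p <= choice_value y r (f r).
Proof.
move=> rb; have := y_le1 (b, s, [ffun r' => if r' == r then p else f r']).
rewrite -y_eq1 !pairingE lerD2l (bigD1 r)//= [leRHS](bigD1 r)//= ffunE eqxx.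
rewrite (eq_bigr (fun r' => choice_value y r' (f r'))) ?lerD2r//.
by move=> r' /andP[_ /negPf r'r]; rewrite ffunE r'r.
Qed.

(** The other vector has [r] as special row and an ordinary entry in row [b]. *)
Lemma optimal_row r p s' : r != b ->
  pattern_value y r s' + choice_value y b p <=
  pattern_value y b s + choice_value y r (f r).
Proof.
move=> rb; have := y_le1 (r, s', [ffun r' => if r' == b then p else f r']).
rewrite -y_eq1 !pairingE (bigD1 b) 1?eq_sym//= [leRHS](_ : _ = pattern_value y b s +
  (choice_value y r (f r) + \sum_(i | (i != b) && (i != r)) choice_value y i (f i))).
  rewrite ffunE eqxx !addrA (eq_bigl (fun i => (i != b) && (i != r))) => [|i].
    rewrite (eq_bigr (fun r' => choice_value y r' (f r'))) ?lerD2r//.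
    by move=> r' /andP[/negPf r'b _]; rewrite ffunE r'b.
  by rewrite andbC.
by congr (_ + _); rewrite (bigD1 r).
Qed.

(** Otherwise some other row has a positive value, and making it the special
    row would double that value. *)
Lemma optimal_pattern_value_gt0 : 0 < pattern_value y b s.
Proof.
have [//|v0] := ltP 0 (pattern_value y b s).
have [r /andP[rb fr]] : exists r, (r != b) && (0 < choice_value y r (f r)).
  apply/existsP; apply: contraT => /existsPn nr.
  have : (1 : R) <= 0.
    rewrite -y_eq1 pairingE -[leRHS]addr0 lerD//.
    by apply: sumr_le0 => r rb; have := nr r; rewrite rb/= -leNgt.
  by rewrite ler10.
pose s1 : pattern := [ffun c => if c == (f r).1 then Some (f r).2 else None].
have s1sz : pattern_size s1 = 1%N.
  rewrite /pattern_size (bigD1 (f r).1)//= ffunE eqxx big1 ?addn0// => c.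
  by rewrite ffunE => /negPf ->.
have [e eE] := choice_value_abs y b b.
have := optimal_row (b, e) s1 rb.
rewrite eE /pattern_value s1sz invr1.
have -> : pattern_sum y r s1 = choice_value y r (f r).
  rewrite /pattern_sum (bigD1 (f r).1)//= ffunE eqxx big1 ?addr0// => c.
  by rewrite ffunE => /negPf -> /=; rewrite mulr0.
have := normr_ge0 (y b b); rewrite -/(pattern_value y b s); lra.
Qed.

Lemma optimal_sum_gt0 : 0 < pattern_sum y b s.
Proof.
have := optimal_pattern_value_gt0; rewrite /pattern_value pmulr_rgt0//.
Qed.

(** Deleting a column with an entry of the wrong sign would not decrease the sum
    and would increase the weight [1 + 1/j]. *)
Lemma optimal_entry c : s c != None -> 0 < y b c * entry_sign (s c).
Proof.
move=> sc; rewrite ltNge; apply/negP => z0.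
have := optimal_pattern (set_entry s c None).
have := set_entry_size s c None; rewrite sc addn0 addn1 => szE.
have sum' := set_entry_sum y b s c None; rewrite mulr0 addr0 in sum'.
have s0 := optimal_sum_gt0.
have s'0 : 0 < pattern_sum y b (set_entry s c None) by rewrite sum'; lra.
have := pattern_sum_size s'0; rewrite /pattern_value -szE.
set k := pattern_size (set_entry s c None) => k0.
rewrite leNgt => /negP; apply; rewrite -natr1.
have k1 : (0 : R) < k%:R by rewrite ltr0n.
apply: (@lt_le_trans _ _ ((1 + k%:R^-1) * pattern_sum y b s)).
  by rewrite ltr_pM2r// ltrD2l ltf_pV2 ?posrE ?addr_gt0// ltrDl.
rewrite ler_pM2l; first by rewrite sum'; lra.
by rewrite addr_gt0 ?invr_gt0.
Qed.

(** Adding the column [c] to a set of size [j] with sum [S] must not increase the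
    value: [(1 + 1/(j+1)) (S + |y_c|) <= (1 + 1/j) S].  In particular [|y_c|] is
    less than the average [S / j]. *)
Lemma optimal_outside c : s c = None ->
  `|y b c| * ((pattern_size s)%:R + 2) * (pattern_size s)%:R <= pattern_sum y b s.
Proof.
move=> sc; have [e eE] := choice_value_abs y b c.
have := optimal_pattern (set_entry s c (Some e)).
have := set_entry_size s c (Some e); rewrite sc addn0 addn1 /pattern_value => ->.
rewrite set_entry_sum sc mulr0 subr0 [y b c * _]eE -natr1.
have := optimal_sum_gt0; have := pattern_sum_size optimal_sum_gt0.
rewrite -(ltr0n R); set k : R := _%:R; set S := pattern_sum y b s.
move: (`|y b c|) => a k0 S0.
have k1 : 0 < k + 1 by rewrite addr_gt0.
rewrite -(ler_pM2r (mulr_gt0 k0 k1)).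
rewrite (_ : _ * (S + a) * _ = (k + 2) * k * (S + a)); last first.
  by field; rewrite gt_eqF.
rewrite (_ : _ * S * _ = (k + 1) * (k + 1) * S); last by field; rewrite gt_eqF.
by lra.
Qed.

End OneVertex.

(** If the two sets of columns were disjoint, [optimal_outside] would make the
    average of [|y|] over each of them less than the average over the other. *)
Lemma optimal_pair_same_row b s f s' f' :
  pairing y (b, s, f) = 1 -> pairing y (b, s', f') = 1 ->
  exists c, (s c != None) && (s' c != None).
Proof.
move=> y1 y1'; apply/existsP; apply: contraT => /existsPn disj.
have key u g u' g' : pairing y (b, u, g) = 1 -> pairing y (b, u', g') = 1 ->
    (forall c, ~~ ((u c != None) && (u' c != None))) ->
    pattern_sum y b u' * ((pattern_size u)%:R + 2) * (pattern_size u)%:R <=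
    (pattern_size u')%:R * pattern_sum y b u.
  move=> yu yu' dis; rewrite /pattern_size [in leRHS]natr_sum mulr_suml.
  rewrite {1}/pattern_sum !mulr_suml; apply: ler_sum => c _.
  have := dis c; case u'c : (u' c) => [e|]; last by rewrite mulr0 !mul0r.
  rewrite andbT negbK => /eqP uc; rewrite mul1r.
  apply: le_trans (optimal_outside yu uc); rewrite -/(pattern_size u).
  rewrite ler_wpM2r ?ler0n// ler_wpM2r ?addr_ge0 ?ler0n//.
  by apply: (le_trans (ler_norm _)); rewrite normrM normr_sign mulr1.
have := key _ _ _ _ y1 y1' disj.
have disj' c : ~~ ((s' c != None) && (s c != None)) by rewrite andbC.
have := key _ _ _ _ y1' y1 disj'.
have := pattern_sum_size (optimal_sum_gt0 y1).
have := pattern_sum_size (optimal_sum_gt0 y1').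
have := optimal_sum_gt0 y1; have := optimal_sum_gt0 y1'.
rewrite -!(ltr0n R).
move: (pattern_sum y b s) (pattern_sum y b s') => S S'.
move: (pattern_size s)%:R (pattern_size s')%:R => k k' S'0 S0 k'0 k0 h1 h2.
have Sk : 0 < S * k' by rewrite mulr_gt0.
have Skk : 0 < S * k' * k' by rewrite !mulr_gt0.
have S'k : 0 < S' * k by rewrite mulr_gt0.
have S'kk : 0 < S' * k * k by rewrite !mulr_gt0.
by lra.
Qed.

(** When the special rows differ, the second vector selects in row [b] an entry
    where [|y|] is maximal; by [optimal_outside] the set of columns of the first
    vector contains that entry.  All entries of either vector that are nonzero
    in row [b] and in the set of the first one have the sign of [y]. *)
Lemma optimal_pair_overlap b s f b' s' f' :
  pairing y (b, s, f) = 1 -> pairing y (b', s', f') = 1 ->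
  (forall c, 0 <= grid_vector (b, s, f) b c * grid_vector (b', s', f') b c) /\
  exists c, 0 < grid_vector (b, s, f) b c * grid_vector (b', s', f') b c.
Proof.
move=> y1 y1'; rewrite /= eqxx.
have pos u : 0 < 1 + (pattern_size u)%:R^-1 :> R.
  by rewrite ltr_pwDl// invr_ge0 ler0n.
have same x z w : 0 < x * z -> 0 < x * w -> 0 < z * w :> R.
  move=> xz xw; have := mulr_gt0 xz xw.
  rewrite mulrACA -expr2 pmulr_rgt0// lt_neqAle sqr_ge0 andbT eq_sym sqrf_eq0.
  by apply: contraTneq xz => ->; rewrite mul0r ltxx.
have [bb'|bb'] := eqVneq b b'.
  rewrite -bb' in y1' *.
  have prod_gt0 c : s c != None -> s' c != None ->
      0 < (1 + (pattern_size s)%:R^-1) * entry_sign (s c) *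
          ((1 + (pattern_size s')%:R^-1) * entry_sign (s' c)).
    move=> sc s'c; rewrite mulrACA; apply: mulr_gt0; first by rewrite mulr_gt0.
    exact: same _ _ _ (optimal_entry y1 sc) (optimal_entry y1' s'c).
  split=> [c|].
    have [sc|sc] := eqVneq (s c) None; first by rewrite sc mulr0 mul0r.
    have [s'c|s'c] := eqVneq (s' c) None; first by rewrite s'c !mulr0.
    by rewrite ltW// prod_gt0.
  have [c /andP[sc s'c]] := optimal_pair_same_row y1 y1'.
  by exists c; exact: prod_gt0.
set p := f' b.
have p_max c : `|y b c| <= choice_value y b p.
  have [e <-] := choice_value_abs y b c.
  have yc := optimal_choice y1' (c, e) bb'; exact: yc.
have S0 := optimal_sum_gt0 y1.
have S_le : pattern_sum y b s <= (pattern_size s)%:R * choice_value y b p.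
  rewrite /pattern_size natr_sum mulr_suml; apply: ler_sum => c _.
  case sc : (s c) => [e|]; last by rewrite mulr0 mul0r.
  rewrite mul1r; apply: le_trans (p_max c); apply: (le_trans (ler_norm _)).
  by rewrite normrM normr_sign mulr1.
have k0 : 0 < (pattern_size s)%:R :> R by rewrite ltr0n; exact: pattern_sum_size S0.
have p0 : 0 < choice_value y b p by rewrite -(pmulr_rgt0 _ k0) (lt_le_trans S0).
have sp : s p.1 != None.
  apply/eqP => /(optimal_outside y1).
  have -> : `|y b p.1| = choice_value y b p.
    by rewrite -(gtr0_norm p0) normrM normr_sign mulr1.
  move: k0 S_le p0 S0; move: (pattern_size s)%:R (pattern_sum _ _ _).
  move: (choice_value _ _ _) => x k S k0 *; have : 0 < x * k by rewrite mulr_gt0.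
  have : 0 < x * k * k by rewrite !mulr_gt0.
  nra.
have prod_gt0 : 0 < (1 + (pattern_size s)%:R^-1) * entry_sign (s p.1) * (-1) ^+ p.2.
  rewrite -mulrA mulr_gt0 ?pos//.
  exact: same _ _ _ (optimal_entry y1 sp) p0.
split=> [c|]; last by exists p.1; rewrite eqxx.
by have [->|_] := eqVneq c p.1; [exact: ltW|rewrite mulr0].
Qed.

End Optimal.

Definition grid_opp t : grid_index :=
  let: (b, s, f) := t in
  (b, [ffun c => omap negb (s c)], [ffun r => ((f r).1, ~~ (f r).2)]).

Lemma grid_oppE t r c : grid_vector (grid_opp t) r c = - grid_vector t r c.
Proof.
case: t => -[b s] f /=; rewrite !ffunE /=.
have -> : pattern_size [ffun c => omap negb (s c)] = pattern_size s.
  by apply: eq_bigr => c' _; rewrite ffunE; case: (s c').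
case: ifP => _; last by case: ifP => _; rewrite ?oppr0// signrN.
rewrite -mulrN; congr (_ * _).
by case: (s c) => [e|] /=; rewrite ?oppr0// signrN.
Qed.

Lemma pairing_opp y t : pairing y (grid_opp t) = - pairing y t.
Proof.
rewrite /pairing -sumrN; apply: eq_bigr => r _; rewrite -sumrN.
by apply: eq_bigr => c _; rewrite grid_oppE mulrN.
Qed.

(** The four sign cases reduce to [optimal_pair_overlap] by replacing [y] or the
    second vector by its opposite. *)
Lemma grid_overlap y t t' :
  (forall u, `|pairing y u| <= 1) -> `|pairing y t| = 1 -> `|pairing y t'| = 1 ->
  let g := pairing y t * pairing y t' in
  (forall c, 0 <= g * (grid_vector t t.1.1 c * grid_vector t' t.1.1 c)) /\
  exists c, 0 < g * (grid_vector t t.1.1 c * grid_vector t' t.1.1 c).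
Proof.
move=> y_le yt yt' g.
have le1 z : (forall u, `|pairing z u| <= 1) -> forall u, pairing z u <= 1.
  by move=> zu u; exact: le_trans (ler_norm _) (zu u).
have main z w w' : (forall u, `|pairing z u| <= 1) ->
    pairing z w = 1 -> pairing z w' = 1 ->
    (forall c, 0 <= grid_vector w w.1.1 c * grid_vector w' w.1.1 c) /\
    exists c, 0 < grid_vector w w.1.1 c * grid_vector w' w.1.1 c.
  case: w w' => [[b s] f] [[b' s'] f'] zu.
  exact: optimal_pair_overlap (le1 _ zu) _ _ _ _ _ _.
have sgn x : `|x| = 1 -> x = 1 \/ x = -1 :> R.
  by move=> /eqP; rewrite eqr_norml ler01 andbT => /orP[]/eqP; [left|right].
pose y' r c := - y r c.
have y'E u : pairing y' u = - pairing y u.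
  rewrite /pairing -sumrN; apply: eq_bigr => r _; rewrite -sumrN.
  by apply: eq_bigr => c _; rewrite mulNr.
have y'_le u : `|pairing y' u| <= 1 by rewrite y'E normrN.
rewrite /g; have [e|e] := sgn _ yt; have [e'|e'] := sgn _ yt'; rewrite e e'.
- have [h1 [c h2]] := main _ _ _ y_le e e'.
  by split=> [c'|]; [|exists c]; rewrite !mul1r.
- have [|h1 [c h2]] := main _ _ (grid_opp t') y_le e.
    by rewrite pairing_opp e' opprK.
  split=> [c'|]; [have := h1 c'|exists c; move: h2];
    by rewrite grid_oppE mul1r mulN1r mulrN.
- have [||h1 [c h2]] := main _ t (grid_opp t') y'_le.
  + by rewrite y'E e opprK.
  + by rewrite pairing_opp y'E e' opprK.
  split=> [c'|]; [have := h1 c'|exists c; move: h2];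
    by rewrite grid_oppE mulr1 mulN1r mulrN.
- have [||h1 [c h2]] := main _ t t' y'_le.
  + by rewrite y'E e opprK.
  + by rewrite y'E e' opprK.
  by split=> [c'|]; [|exists c]; rewrite mulrNN !mul1r.
Qed.

(** Different relative signs on two faces would require an entry that is both
    positive and nonpositive in the special row of [t]. *)
Lemma grid_coherent y y' t t' :
  (forall u, `|pairing y u| <= 1) -> (forall u, `|pairing y' u| <= 1) ->
  `|pairing y t| = 1 -> `|pairing y t'| = 1 ->
  `|pairing y' t| = 1 -> `|pairing y' t'| = 1 ->
  pairing y t * pairing y t' = pairing y' t * pairing y' t'.
Proof.
move=> y_le y'_le h1 h2 h3 h4.
have [_ [c gc]] := grid_overlap y_le h1 h2.
have [/(_ c) g'c _] := grid_overlap y'_le h3 h4.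
have sgn x z : `|x| = 1 -> `|z| = 1 -> x * z = 1 \/ x * z = -1 :> R.
  move=> x1 z1; have /eqP : `|x * z| = 1 by rewrite normrM x1 z1 mulr1.
  by rewrite eqr_norml ler01 andbT => /orP[]/eqP; [left|right].
move: gc g'c; have [->|->] := sgn _ _ h1 h2; have [->|->] := sgn _ _ h3 h4 => //; lra.
Qed.

Lemma pairing_separates y : (forall t, pairing y t = 0) -> forall r c, y r c = 0.
Proof.
move=> y0 r c; pose f : transversal := [ffun=> (c, true)].
pose s0 : pattern := [ffun=> None].
have : pairing y (r, set_entry s0 c (Some false), f) = pairing y (r, s0, f).
  by rewrite !y0.
rewrite !pairingE => /addIr; rewrite /pattern_value set_entry_sum.
have -> : pattern_sum y r s0 = 0.
  by rewrite /pattern_sum big1// => c' _; rewrite ffunE mulr0.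
rewrite ffunE /= mulr0 subrr add0r !mulr1 mulr0 => /eqP.
rewrite mulf_eq0 => /orP[|/eqP//].
by rewrite gt_eqF// ltr_pwDl// invr_ge0 ler0n.
Qed.

Lemma card_grid_index : #|{: grid_index}| = (q * 3 ^ q * (q * 2) ^ q)%N.
Proof.
by rewrite !card_prod !card_ffun card_option card_prod card_bool !card_ord.
Qed.

End Grid.

(** When [d.+1] is less than [q * q], the grid vectors are projected on [d.+1] of
    the coordinates: the pairing of a projected vector with [y] is the pairing
    of the grid vector with [y] extended by zero, so coherence is inherited. *)
Theorem grid_triangulation (R : realType) (d q : nat) : (d.+1 <= q * q)%N ->
  exists (m : nat) (K : simplicial_complex m),
    triangulates R K (real_projective_space R d) /\
    (m <= q * 3 ^ q * (q * 2) ^ q)%N.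
Proof.
move=> dq.
have [phi phi_inj] : exists phi : 'I_d.+1 -> 'I_q * 'I_q, injective phi.
  have cardE : (q * q = #|{: 'I_q * 'I_q}|)%N by rewrite card_prod card_ord.
  exists (fun i => enum_val (cast_ord cardE (widen_ord dq i))) => i j.
  by move=> /enum_val_inj/cast_ord_inj/(congr1 val)/= /val_inj.
pose v (k : 'I_#|{: grid_index q}|) : 'rV[R]_d.+1 :=
  \row_i grid_vector R (enum_val k) (phi i).1 (phi i).2.
(* Summing over the fibre of [phi] is the extension by zero. *)
pose unroll (y : 'rV[R]_d.+1) r c : R := \sum_(i | phi i == (r, c)) y 0 i.
have dotE y k : dot y (v k) = pairing (unroll y) (enum_val k).
  rewrite /dot (partition_big phi xpredT)//= /pairing pair_big/=.
  apply: eq_bigr => -[r c] _ /=; rewrite mulr_suml.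
  by apply: eq_bigr => i /eqP phiE; rewrite mxE phiE.
have all_index (P : grid_index q -> Prop) :
    (forall k, P (enum_val (k : 'I_#|{: grid_index q}|))) -> forall t, P t.
  by move=> Pk t; rewrite -(enum_rankK t).
have v_spanning : spanning v.
  move=> p; have [//|[z zv]] := span_or_separate v p.
  suff -> : z = 0 by rewrite dot0l ltxx.
  have z0 : forall t, pairing (unroll z) t = 0.
    by apply: all_index => k; rewrite -dotE.
  apply/rowP => i; rewrite mxE.
  have := pairing_separates z0 (phi i).1 (phi i).2.
  rewrite /unroll (big_pred1 i)// => j.
  by rewrite -surjective_pairing/= (inj_eq phi_inj).
have v_coherent : faces_coherent v.
  move=> y y' i j yv y'v; rewrite !dotE; apply: grid_coherent.
    by apply: all_index => k; rewrite -dotE; exact: yv.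
  by apply: all_index => k; rewrite -dotE; exact: y'v.
have [m [K [mK mle]]] := triangulation_of_family v_spanning v_coherent.
by exists m, K; split=> //; rewrite -card_grid_index.
Qed.

(** * Counting the vertices *)

(** For [n = 1] the bound allows a single vertex, because [ln 1 = 0]. *)
Lemma rp0_triangulation (R : realType) :
  exists (m : nat) (K : simplicial_complex m),
    triangulates R K (real_projective_space R 0) /\ (m <= 1)%N.
Proof.
apply: (@triangulation_of_family _ _ _ (fun=> const_mx 1)).
  move=> p; exists p; rewrite big_ord1.
  by apply/rowP => i; rewrite !mxE mulr1 (ord1 i).
move=> y y' i j _ _ y1 _ y1' _.
by rewrite -!expr2 -!(real_normK (num_real (dot _ _))) y1 y1'.
Qed.

Lemma sqrt_ceiling (R : realType) (n : nat) : (0 < n)%N ->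
  exists q : nat, [/\ (0 < q)%N, (n <= q * q)%N & q%:R <= Num.sqrt n%:R + 1 :> R].
Proof.
move=> n0; have ex : exists q, (n <= q * q)%N by exists n; rewrite leq_pmulr.
have [q nq qmin] := ex_minnP ex.
case: q => [|p] in nq qmin *; first by rewrite leqNgt n0 in nq.
exists p.+1; split=> //; rewrite -natr1 lerD2r.
have pn : (p * p <= n)%N.
  by rewrite leqNgt; apply/negP => /ltnW/qmin; rewrite ltnn.
by rewrite -[leLHS]ger0_norm// -sqrtr_sqr ler_sqrt ?ler0n// -natrX ler_nat.
Qed.

Lemma ln_card_grid_index (R : realType) (q : nat) : (0 < q)%N ->
  ln (q * 3 ^ q * (q * 2) ^ q)%:R =
  ln q%:R + q%:R * (ln 3 + ln 2 + ln q%:R) :> R.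
Proof.
move=> q0; have q0R : 0 < q%:R :> R by rewrite ltr0n.
rewrite !natrM !natrX !lnM ?posrE ?mulr_gt0 ?exprn_gt0 ?natrM ?mulr_gt0//.
rewrite !lnXn ?mulr_gt0// lnM ?posrE// -!(mulr_natl (ln _)) -mulr_natl; ring.
Qed.

(** The coefficient of [sqrt n] obtained from [q <= sqrt n + 1] and
    [ln q <= ln (2 sqrt n)], after bounding the constant terms by multiples of
    [sqrt n]. *)
Definition error_constant (R : realType) : R := 2 * ln 3 + 5 * ln 2.

Lemma ln_card_grid_le (R : realType) (n q : nat) : (0 < n)%N -> (0 < q)%N ->
  q%:R <= Num.sqrt n%:R + 1 :> R ->
  ln (q * 3 ^ q * (q * 2) ^ q)%:R <=
  1 / 2 * Num.sqrt n%:R * ln n%:R + ln n%:R + error_constant R * Num.sqrt n%:R.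
Proof.
move=> n0 q0 qS; rewrite ln_card_grid_index// /error_constant.
have n1 : 1 <= n%:R :> R by rewrite ler1n.
set S : R := Num.sqrt n%:R in qS *.
have S1 : 1 <= S by rewrite -sqrtr1 ler_sqrt// ler0n.
have S0 : 0 < S by exact: lt_le_trans ltr01 S1.
have L0 : 0 <= ln n%:R :> R by exact: ln_ge0.
have a0 : 0 <= ln 2 :> R by apply: ln_ge0; rewrite ler1n.
have b0 : 0 <= ln 3 :> R by apply: ln_ge0; rewrite ler1n.
have nS : ln n%:R = 2 * ln S.
  by rewrite -[n%:R]sqr_sqrtr ?ler0n// lnXn// mulr_natl.
have lnq : ln q%:R <= ln 2 + ln S.
  rewrite -lnM ?posrE// ler_ln ?posrE ?ltr0n ?mulr_gt0//.
  by apply: (le_trans qS); lra.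
have lnS : 0 <= ln S by exact: ln_ge0.
apply: (@le_trans _ _ ((ln 2 + ln S) + (S + 1) * (ln 3 + ln 2 + (ln 2 + ln S)))).
  apply: lerD => //; apply: (@le_trans _ _ (q%:R * (ln 3 + ln 2 + (ln 2 + ln S)))).
    by rewrite ler_wpM2l// lerD2l.
  by rewrite ler_wpM2r// !addr_ge0.
rewrite nS; move: (ln S) (ln 2) (ln 3) a0 b0 lnS {nS lnq L0} => T a b a0 b0 T0.
nra.
Qed.

Definition error_term (R : realType) (n : nat) : R :=
  (Num.sqrt n%:R)^-1 + error_constant R / ln n%:R.

Lemma cvg_inv_sqrt (R : realType) : (Num.sqrt n%:R : R)^-1 @[n --> \oo] --> (0 : R).
Proof.
apply/gtr0_cvgV0.
  by near=> n; rewrite sqrtr_gt0 ltr0n; near: n; exact: nbhs_infty_gt.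
apply/cvgryPge => A; have /cvgryPge/(_ (A ^+ 2)) := @cvgr_idn R.
apply: filterS => n An; apply: (le_trans (ler_norm A)).
by rewrite -sqrtr_sqr ler_sqrt// (le_trans _ An)// sqr_ge0.
Unshelve. all: by end_near. Qed.

Lemma cvg_inv_ln (R : realType) : (ln n%:R : R)^-1 @[n --> \oo] --> (0 : R).
Proof.
apply/gtr0_cvgV0.
  by near=> n; rewrite ln_gt0// ltr1n; near: n; exact: nbhs_infty_gt.
apply/cvgryPge => A; have /cvgryPge/(_ (expR A)) := @cvgr_idn R.
apply: filterS => n An; rewrite -(expRK A) ler_ln ?posrE ?expR_gt0//.
exact: lt_le_trans (expR_gt0 A) An.
Unshelve. all: by end_near. Qed.

Lemma error_term_cvg0 (R : realType) : error_term R n @[n --> \oo] --> 0.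
Proof.
rewrite -[0 in X in _ --> X](addr0 (0 : R)) -[X in _ + X](mulr0 (error_constant R)).
apply: cvgD; first exact: cvg_inv_sqrt.
apply: cvgM; [exact: cvg_cst|exact: cvg_inv_ln].
Qed.

Theorem corollary2p2 (R : realType) :
  exists eps : nat -> R,
    eps n @[n --> \oo] --> 0 /\
    forall n : nat, (0 < n)%N ->
      exists (m : nat) (K : simplicial_complex m),
        triangulates R K (real_projective_space R n.-1) /\
        m%:R <= expR ((1 / 2 + eps n) * Num.sqrt n%:R * ln n%:R).
Proof.
exists (error_term R); split; first exact: error_term_cvg0.
move=> [//|[|n]] _.
  have [m [K [mK m1]]] := rp0_triangulation R.
  by exists m, K; split=> //; rewrite ln1 mulr0 expR0 (ler_nat R m 1).
have [q [q0 nq qS]] := sqrt_ceiling R (ltn0Sn n.+1).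
have [m [K [mK mle]]] := grid_triangulation R nq.
exists m, K; split=> //.
have N0 : (0 < q * 3 ^ q * (q * 2) ^ q)%N by rewrite !muln_gt0 !expn_gt0 muln_gt0 q0.
apply: (@le_trans _ _ (q * 3 ^ q * (q * 2) ^ q)%:R); first by rewrite ler_nat.
rewrite -[leLHS]lnK ?posrE ?ltr0n// ler_expR.
apply: (le_trans (ln_card_grid_le (ltn0Sn n.+1) q0 qS)).
have S0 : 0 < Num.sqrt n.+2%:R :> R by rewrite sqrtr_gt0 ltr0n.
have L0 : 0 < ln n.+2%:R :> R by rewrite ln_gt0// ltr1n.
rewrite /error_term le_eqVlt; apply/orP; left; apply/eqP.
by field; rewrite !gt_eqF.
Qed.
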